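(* For all integers $r,s\ge 1$, $\chi_{ltna}(rK_2\vee O_{2s+1})=3$.
   Context: All graphs are finite and simple. $rK_2$ is the disjoint union of $r$ copies of $K_2$. $O_m$ is the null (edgeless) graph on $m$ vertices. The join $G\vee H$ of (vertex-disjoint) graphs has $V(G\vee H)=V(G)\cup V(H)$ and $E(G\vee H)=E(G)\cup E(H)\cup\{uv\mid u\in V(G),v\in V(H)\}$. For a graph $G=(V,E)$ of order $p$ and size $q$ without isolated vertices, a bijection $f:V\cup E\to\{1,\dots,p+q\}$ is a local total neighborhood antimagic labeling of $G$ if the induced vertex coloring $f^+_{tn}(u)=\sum_{ux\in E}[f(ux)+f(x)]$ satisfies $f^+_{tn}(u)\ne f^+_{tn}(v)$ for every edge $uv\in E$. The number of distinct induced colors is $c_{tn}(f)$. The local total neighborhood antimagic chromatic number $\chi_{ltna}(G)$ is the minimum of $c_{tn}(f)$ over all local total neighborhood antimagic labelings $f$ of $G$; an assertion $\chi_{ltna}(G)=k$ includes the assertion that $G$ admits such a labeling. *)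

(* Defs.v *)
From mathcomp Require Import all_boot.
Set Implicit Arguments.
Unset Strict Implicit.
Unset Printing Implicit Defensive.

Record sgraph := SGraph {
  vertex :> finType;
  adj : rel vertex;
  adj_sym : symmetric adj;
  adj_irrefl : irreflexive adj
}.

Definition edges (G : sgraph) : {set {set G}} :=
  [set [set e.1; e.2] | e : G * G & adj e.1 e.2].

Definition order_of (G : sgraph) : nat := #|G|.
Definition size_of (G : sgraph) : nat := #|edges G|.

Definition no_isolated (G : sgraph) : Prop := forall u : G, exists v : G, adj u v.

Lemma complete_sym n : symmetric (fun i j : 'I_n => i != j).
Proof. by move=> i j; rewrite eq_sym. Qed.
Lemma complete_irrefl n : irreflexive (fun i j : 'I_n => i != j).
Proof. by move=> i; rewrite eqxx. Qed.
Definition complete_graph (n : nat) : sgraph :=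
  SGraph (@complete_sym n) (@complete_irrefl n).

Lemma null_sym n : symmetric (fun _ _ : 'I_n => false).
Proof. by []. Qed.
Lemma null_irrefl n : irreflexive (fun _ _ : 'I_n => false).
Proof. by []. Qed.
Definition null_graph (n : nat) : sgraph := SGraph (@null_sym n) (@null_irrefl n).

Definition copies_adj (r : nat) (G : sgraph) : rel ('I_r * G) :=
  fun x y => (x.1 == y.1) && adj x.2 y.2.
Lemma copies_sym r G : symmetric (@copies_adj r G).
Proof. by move=> x y; rewrite /copies_adj eq_sym adj_sym. Qed.
Lemma copies_irrefl r G : irreflexive (@copies_adj r G).
Proof. by move=> x; rewrite /copies_adj adj_irrefl andbF. Qed.
Definition copies (r : nat) (G : sgraph) : sgraph :=
  SGraph (@copies_sym r G) (@copies_irrefl r G).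

Definition join_adj (G H : sgraph) : rel (G + H) := fun x y =>
  match x, y with
  | inl u, inl v => adj u v
  | inr u, inr v => adj u v
  | _, _ => true
  end.
Lemma join_sym G H : symmetric (@join_adj G H).
Proof. by move=> [u|u] [v|v] //=; rewrite adj_sym. Qed.
Lemma join_irrefl G H : irreflexive (@join_adj G H).
Proof. by move=> [u|u] /=; rewrite adj_irrefl. Qed.
Definition join (G H : sgraph) : sgraph := SGraph (@join_sym G H) (@join_irrefl G H).

(* The set V(G) + E(G), inside the ambient type G + {set G}.  A labeling is a
   function on the whole ambient type; its values on sets that are not edges
   are never used. *)
Definition elements (G : sgraph) : {set G + {set G}} :=
  [set z : G + {set G} | if z is inr A then A \in edges G else true].

Definition total_labeling (G : sgraph) (f : G + {set G} -> nat) : Prop :=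
  {in elements G &, injective f} /\
  (forall k : nat, (1 <= k <= order_of G + size_of G) <->
                   exists2 z, z \in elements G & f z = k).

Definition tn_color (G : sgraph) (f : G + {set G} -> nat) (u : G) : nat :=
  \sum_(x : G | adj u x) (f (inr [set u; x]) + f (inl x)).

Definition ltna_labeling (G : sgraph) (f : G + {set G} -> nat) : Prop :=
  total_labeling f /\ (forall u v : G, adj u v -> tn_color f u <> tn_color f v).

Definition num_colors (G : sgraph) (f : G + {set G} -> nat) : nat :=
  size (undup (codom (tn_color f))).

(* chi_ltna(G) = k.  Stated as a relation because the minimum exists only when
   G admits a labeling; the notion is reserved to graphs without isolated
   vertices. *)
Definition chi_ltna_is (G : sgraph) (k : nat) : Prop :=
  [/\ no_isolated G,
      exists2 f : G + {set G} -> nat, ltna_labeling f & num_colors f = k &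
      forall f : G + {set G} -> nat, ltna_labeling f -> k <= num_colors f].

(* Main.v *)
(** For every i, the vertices of the i-th copy of K_2 and one vertex of O_n,
    n = 2s+1, form a triangle, so three colors are needed. For the upper bound,
    let u_i v_i be the i-th copy, e_i its edge and w_j the vertices of O_n. The
    labels of the edges u_i w_j fill, for fixed j, a block of r consecutive
    integers, those of v_i w_j fill the mirror block, and the u_i and the v_i
    fill two further blocks; the colors of the w_j then agree whatever the order
    inside the mirrored blocks. All orders
    are i or its reversal, apart from a permutation y of [0, r) and the order z
    of the labels of the e_i, with i + y i - z i constant: this makes the colors
    of the u_i agree, and those of the v_i. For even r such y, z exist only if
    z skips a value of [0, r], which becomes the label of w_0. Finally,
    exchanging the label blocks of the u_i and the v_i leaves the color of the
    w_j fixed and yields two new colors for the u_i and the v_i, both different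
    from the old two, so one of the two choices gives three distinct colors. *)
Require Import Defs.
From mathcomp Require Import all_boot.
From mathcomp Require Import zify.

Set Implicit Arguments.
Unset Strict Implicit.
Unset Printing Implicit Defensive.

(** * Triangles and total labelings *)

Lemma num_colors_ge3 (G : sgraph) (f : G + {set G} -> nat) (u v w : G) :
  ltna_labeling f -> adj u v -> adj u w -> adj v w -> 3 <= num_colors f.
Proof.
move=> [_ neq_f] uv uw vw; rewrite /num_colors.
pose s := [:: tn_color f u; tn_color f v; tn_color f w].
apply: (@leq_trans (size s)) => //; apply: uniq_leq_size.
  by rewrite /= !inE negb_or !andbT; apply/andP; split; [apply/andP; split|];
    apply/eqP; apply: neq_f.
by move=> k; rewrite mem_undup !inE => /or3P[] /eqP->; apply: codom_f.
Qed.

Lemma card_elements (G : sgraph) : #|elements G| = order_of G + size_of G.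
Proof.
rewrite -sum1_card big_sumType /= /order_of /size_of -!sum1_card.
by congr (_ + _); apply: eq_bigl => x; rewrite inE.
Qed.

(** Lets a labeling be given by an injection [L] on vertices and enumerated edges. Only the upper
    bound has to be checked: by counting, [L] then attains every value. *)
Lemma total_labeling_of_edge_enum (G : sgraph) (E : finType) (es : E -> {set G})
    (L : G + E -> nat) :
  injective es -> (forall A, reflect (exists e, A = es e) (A \in edges G)) ->
  injective L -> (forall t, 1 <= L t <= #|G| + #|E|) ->
  exists2 f : G + {set G} -> nat, total_labeling f &
    (forall v, f (inl v) = L (inl v)) /\ (forall e, f (inr (es e)) = L (inr e)).
Proof.
move=> es_inj esP L_inj L_bd.
pose f (x : G + {set G}) : nat := match x with
  | inl v => L (inl v)
  | inr A => if [pick e | es e == A] is Some e then L (inr e) else 0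
  end.
have f_es e : f (inr (es e)) = L (inr e).
  rewrite /=; case: pickP => [e' /eqP/es_inj->//|/(_ e)]; by rewrite eqxx.
pose g (t : G + E) : G + {set G} := match t with
  | inl v => inl v | inr e => inr (es e) end.
have fg t : f (g t) = L t by case: t => [//|e]; apply: f_es.
have g_inj : injective g by move=> t t' /(congr1 f); rewrite !fg => /L_inj.
have gP z : reflect (exists t, z = g t) (z \in elements G).
  rewrite inE; apply: (iffP idP).
    case: z => [v _|A /esP[e ->]]; [by exists (inl v)|by exists (inr e)].
  by move=> [[v|e] ->] //=; apply/esP; exists e.
have cardE : order_of G + size_of G = #|G| + #|E|.
  rewrite -card_elements -card_sum -(card_imset _ g_inj); apply: eq_card => z.
  apply/gP/imsetP => [[t ->]|[t _ ->]]; by exists t.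
exists f => //; split.
  by move=> _ _ /gP[t ->] /gP[t' ->]; rewrite !fg => /L_inj->.
move=> k; rewrite cardE; split; last by move=> [_ /gP[t ->] <-]; rewrite fg.
move=> k_bd.
have [|||_ memL] := @uniq_min_size _ (codom L) (iota 1 (#|G| + #|E|)).
- by rewrite codomE map_inj_uniq ?enum_uniq.
- by move=> _ /codomP[t ->]; rewrite mem_iota add1n ltnS.
- by rewrite size_iota size_codom card_sum.
have /codomP[t ->]: k \in codom L by rewrite memL mem_iota add1n ltnS.
by exists (g t); [apply/gP; exists t | apply: fg].
Qed.

(** * Blocks, offsets and permutations *)

Lemma mixed_radix_inj (r B b o b' o' : nat) :
  b <= B -> b' <= B -> (b < B -> o < r) -> (b' < B -> o' < r) ->
  b * r + o = b' * r + o' -> b = b' /\ o = o'.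
Proof.
move=> bB b'B ob ob' eq_l.
suff eq_b : b = b' by split=> //; move: eq_l; rewrite eq_b; lia.
(* The smaller block number is below [B], so its offset is less than [r] and cannot reach the next
   block. *)
case: (ltngtP b b') => // lt_b; [have := ob ltac:(lia)|have := ob' ltac:(lia)];
  nia.
Qed.

Lemma sum_inj_lt (r : nat) (h : nat -> nat) :
  (forall i, i < r -> h i < r) ->
  (forall i j, i < r -> j < r -> h i = h j -> i = j) ->
  \sum_(i < r) h i = \sum_(i < r) i.
Proof.
move=> h_lt h_inj; pose p (i : 'I_r) := Ordinal (h_lt i (ltn_ord i)).
rewrite [RHS](reindex_inj (h := p)) // => i j /(congr1 val) /= /h_inj eq_ij.
by apply/val_inj/eq_ij.
Qed.

(* [zig] and [zag] are the orders y and z of the header, [gap] is the value of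
   [0, r] skipped by z. *)
Definition zig (r i : nat) : nat :=
  if i < uphalf r then (uphalf r).*2 - 2 - i.*2 else r.*2 - 1 - i.*2.
Definition zag (r i : nat) : nat :=
  if i < uphalf r then uphalf r - 1 - i else r + r./2 - i.
Definition gap (r : nat) : nat := if odd r then r else r./2.

Lemma zig_lt r i : i < r -> zig r i < r.
Proof. rewrite /zig; case: ifP; lia. Qed.

(** The first half of the indices takes the even values below [r], the second half the odd ones. *)
Lemma zig_inj r i j : i < r -> j < r -> zig r i = zig r j -> i = j.
Proof. rewrite /zig; case: ifP; case: ifP; lia. Qed.

Lemma zag_le r i : i < r -> zag r i <= r.
Proof. rewrite /zag; case: ifP; lia. Qed.

Lemma zag_inj r i j : i < r -> j < r -> zag r i = zag r j -> i = j.
Proof. rewrite /zag; case: ifP; case: ifP; lia. Qed.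

(** The first half descends from [uphalf r - 1] to 0, the second half down to [r./2 + 1], starting
    at [r] for even [r] and at [r - 1] for odd [r]. *)
Lemma zag_neq_gap r i : i < r -> zag r i <> gap r.
Proof. rewrite /zag /gap; case: ifP; case: ifP; lia. Qed.

Lemma gap_le r : gap r <= r.
Proof. rewrite /gap; case: ifP; lia. Qed.

Lemma add_zig r i : i < r -> i + zig r i = zag r i + (uphalf r).-1.
Proof. rewrite /zig /zag; case: ifP; lia. Qed.

Definition off (r j i : nat) : nat :=
  if j == 1 then zig r i else if odd j then r - 1 - i else i.

Lemma off_lt r j i : i < r -> off r j i < r.
Proof.
by rewrite /off => ir; case: ifP => _; [apply: zig_lt|case: ifP; lia].
Qed.

Lemma off_inj r j i i' : i < r -> i' < r -> off r j i = off r j i' -> i = i'.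
Proof.
by rewrite /off => ir ir'; case: ifP => _; [apply: zig_inj|case: ifP; lia].
Qed.

(** The columns 0, 1, 2 give [i], [zig r i], [i]; each later pair of columns is a reversal and an
    identity, with sum [r - 1]. *)
Lemma sum_off r s i : i < r ->
  \sum_(j < 2 * s.+1 + 1) off r j i = i.*2 + zig r i + s * (r - 1).
Proof.
move=> ir; elim: s => [|s IHs].
  by rewrite !big_ord_recr big_ord0 /off /=; lia.
have -> : 2 * s.+2 + 1 = (2 * s.+1 + 1).+2 by lia.
rewrite 2!big_ord_recr /= IHs /off.
have -> : (2 * s.+1 + 1 == 1) = false by lia.
have -> : ((2 * s.+1 + 1).+1 == 1) = false by lia.
have -> : odd (2 * s.+1 + 1) by lia.
have -> : odd (2 * s.+1 + 1).+1 = false by lia.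
lia.
Qed.

(** * Edges and labels of the join *)

Notation K2join r n := (join (copies r (complete_graph 2)) (null_graph n)).

Definition edge_set r n (e : 'I_r + ('I_r * 'I_2) * 'I_n) : {set K2join r n} :=
  match e with
  | inl i => [set inl (i, ord0); inl (i, ord_max)]
  | inr (x, j) => [set inl x; inr j]
  end.

Lemma ord2P (a : 'I_2) : a = ord0 \/ a = ord_max.
Proof. by case: a => [[|[|//]] ?]; [left|right]; apply: val_inj. Qed.

Lemma edge_set_inj r n : injective (@edge_set r n).
Proof.
move=> [i|[x j]] [i'|[x' j']] /= /setP eqA.
- by have := eqA (inl (i, ord0)); rewrite !inE eqxx /= => /esym/orP[]/eqP[->].
- by have := eqA (inr j'); rewrite !inE eqxx orbT.
- by have := eqA (inr j); rewrite !inE eqxx orbT.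
have := eqA (inl x); have := eqA (inr j); rewrite !inE !eqxx orbT /=.
by move=> /esym/eqP[->]; rewrite orbF => /esym/eqP[->].
Qed.

Lemma edge_setP r n (A : {set K2join r n}) :
  reflect (exists e, A = edge_set e) (A \in edges (K2join r n)).
Proof.
apply: (iffP imsetP) => [[[u v] /= uv ->]|[[i|[x j]] ->]].
- move: u v uv => [[i a]|j] [[i' a']|j'] //=; rewrite inE //=.
  + rewrite /copies_adj /= => /andP[/eqP<-] ne; exists (inl i) => /=.
    case: (ord2P a) (ord2P a') ne => -> [] -> //= _; by rewrite setUC.
  + by move=> _; exists (inr ((i, a), j')).
  + by move=> _; exists (inr ((i', a'), j)); rewrite setUC.
- exists (inl (i, ord0), inl (i, ord_max)) => //.
  by rewrite inE /= /copies_adj /= eqxx.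
- by exists (inl x, inr j) => //; rewrite inE.
Qed.

(* [a = 0] stands for u_i and [a = 1] for v_i; the boolean [c] decides which of
   the two vertex blocks comes first. *)
Definition side (n a j : nat) : nat := if a == 0 then j else n.*2 - 1 - j.
Definition vside (n : nat) (c : bool) (a : nat) : nat :=
  if (a == 0) (+) c then n.*2 else n.*2.+1.

Notation elt r n := (K2join r n + ('I_r + ('I_r * 'I_2) * 'I_n))%type.

(* A label is 1 + block * r + offset with offset < r, except in the last block,
   which collects all e_i and w_j and has r + n elements. *)
Definition block (r n : nat) (c : bool) (t : elt r n) : nat :=
  match t with
  | inl (inl x) => vside n c x.2
  | inl (inr _) | inr (inl _) => n.*2.+2
  | inr (inr (x, j)) => side n x.2 j
  end.

(** In the last block the e_i occupy [0, r] except [r - gap r]; w_0 fills this hole and the other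
    w_j follow from [r + 1] on. *)
Definition offset (r n : nat) (t : elt r n) : nat :=
  match t with
  | inl (inl x) => r - 1 - x.1
  | inl (inr j) => r - (if j == 0 :> nat then gap r else 0) + j
  | inr (inl i) => r - zag r i
  | inr (inr (x, j)) => off r j x.1
  end.

Definition label (r n : nat) (c : bool) (t : elt r n) : nat :=
  (block c t * r + offset t).+1.
Arguments label : clear implicits.

Lemma block_le r n c (t : elt r n) : block c t <= n.*2.+2.
Proof.
case: t => [[[i a]|j]|[i|[[i a] j]]] //=.
  by rewrite /vside; case: ifP; lia.
by rewrite /side; case: ifP; have := ltn_ord j; lia.
Qed.

Lemma offset_lt r n c (t : elt r n) : block c t < n.*2.+2 -> offset t < r.
Proof.
case: t => [[[i a]|j]|[i|[[i a] j]]] /=; rewrite ?ltnn //.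
  by have := ltn_ord i; lia.
by move=> _; apply: off_lt.
Qed.

Lemma label_bounds r n c (t : elt r n) : 0 < n ->
  1 <= label r n c t <= #|K2join r n| + #|{: 'I_r + ('I_r * 'I_2) * 'I_n}|.
Proof.
move=> n0; rewrite !card_sum !card_prod !card_ord /label /=.
have := @offset_lt r n c t; have := block_le c t.
have : offset t < r + n.
  case: t => [[[i a]|j]|[i|[[i a] j]]] /=.
  - by have := ltn_ord i; lia.
  - by have := ltn_ord j; lia.
  - by lia.
  - by have := off_lt j (ltn_ord i); lia.
case: (ltngtP (block c t) n.*2.+2) => [lt_b _ _ /(_ isT)|//|-> ]; last by nia.
by nia.
Qed.

Lemma label_inj r n c : injective (label r n c).
Proof.
move=> t t' [] /(mixed_radix_inj (block_le c t) (block_le c t')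
  (@offset_lt r n c t) (@offset_lt r n c t')) [].
have ord2_eq (a a' : 'I_2) : ((a : nat) == 0) = ((a' : nat) == 0) -> a = a'.
  by case: (ord2P a) (ord2P a') => -> [] ->.
case: t => [[[i a]|j]|[i|[[i a] j]]];
  case: t' => [[[i' a']|j']|[i'|[[i' a'] j']]];
  rewrite /= /vside /side.
all: try (have lti := ltn_ord i); try (have ltj := ltn_ord j);
  try (have lti' := ltn_ord i'); try (have ltj' := ltn_ord j').
(* Elements of different kinds share a block only if they are some e_i and w_j; block numbers settle
   all other mixed cases. *)
all: try by do ?[case: ifP => _]; lia.
- move=> eqb eqo; have -> : i = i' by apply: val_inj => /=; lia.
  rewrite (ord2_eq a a') //.
  by move: eqb; do 2!case: eqP => _; case: c => /=; lia.
- move=> _ eqo; do 2!f_equal; apply: val_inj => /=.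
  by move: eqo (gap_le r); do 2!case: eqP; lia.
- have := @zag_neq_gap r i' lti'; have := gap_le r; have := zag_le lti'.
  by case: eqP; lia.
- have := @zag_neq_gap r i lti; have := gap_le r; have := zag_le lti.
  by case: eqP; lia.
- move=> _ eqo; do 2!f_equal; apply/val_inj/(zag_inj lti lti').
  by have := zag_le lti; have := zag_le lti'; lia.
- move=> eqb; have [eqj eqa] : j = j' /\ a = a'.
    by split; [apply: val_inj => /=|apply: ord2_eq];
      move: eqb; do 2!case: eqP => _; lia.
  by rewrite eqj eqa => /(off_inj lti lti') /val_inj ->.
Qed.

(** * Induced colors *)

Lemma tn_color_K2 (r n : nat) (c : bool)
    (f : K2join r n + {set K2join r n} -> nat)
    (f_vertex : forall v, f (inl v) = label r n c (inl v))
    (f_edge : forall e, f (inr (edge_set e)) = label r n c (inr e))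
    (i : 'I_r) (a : 'I_2) :
  tn_color f (inl (i, a)) =
    label r n c (inr (inl i)) + label r n c (inl (inl (i, rev_ord a)))
    + \sum_(j < n) (label r n c (inr (inr ((i, a), j)))
                    + label r n c (inl (inr j))).
Proof.
rewrite /tn_color big_sumType /=; congr (_ + _).
  rewrite (big_pred1 (i, rev_ord a)) => [|[i' a']]; last first.
    rewrite /= /copies_adj /= [RHS]xpair_eqE eq_sym; congr (_ && _).
    by case: (ord2P a) (ord2P a') => -> [] ->.
  rewrite f_vertex -(f_edge (inl i)) /=; congr (f (inr _) + _).
  have -> : rev_ord a = if a == ord0 then ord_max else ord0.
    by apply: val_inj; case: (ord2P a) => ->.
  by case: (ord2P a) => -> //=; rewrite setUC.
by apply: eq_bigr => j _; rewrite f_vertex -(f_edge (inr ((i, a), j))).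
Qed.

Lemma tn_color_null (r n : nat) (c : bool)
    (f : K2join r n + {set K2join r n} -> nat)
    (f_vertex : forall v, f (inl v) = label r n c (inl v))
    (f_edge : forall e, f (inr (edge_set e)) = label r n c (inr e))
    (j : 'I_n) :
  tn_color f (inr j) =
    \sum_(i < r) \sum_(a < 2) (label r n c (inr (inr ((i, a), j)))
                               + label r n c (inl (inl (i, a)))).
Proof.
rewrite /tn_color big_sumType /= [X in _ + X]big_pred0 // addn0.
rewrite pair_big /=; apply: eq_bigr => -[i a] _.
by rewrite f_vertex -(f_edge (inr ((i, a), j))) /= setUC.
Qed.

(** For each [i] the block numbers add up to (2n - 1) + (4n + 1) = 6n, and the four successors in
    [label] give the 4. *)
Definition null_color (r n : nat) : nat :=
  r * (6 * n * r + 4) + 2 * \sum_(i < r) i + 2 * \sum_(i < r) (r - 1 - i).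

Lemma tn_color_null_const (r n : nat) (c : bool)
    (f : K2join r n + {set K2join r n} -> nat)
    (f_vertex : forall v, f (inl v) = label r n c (inl v))
    (f_edge : forall e, f (inr (edge_set e)) = label r n c (inr e))
    (j : 'I_n) : tn_color f (inr j) = null_color r n.
Proof.
rewrite (tn_color_null f_vertex f_edge) /null_color.
rewrite -(@sum_inj_lt r (off r j)); last first.
- by move=> i i'; apply: off_inj.
- by move=> i; apply: off_lt.
rewrite -[in r * _](card_ord r) -sum_nat_const !big_distrr -!big_split /=.
apply: eq_bigr => i _; rewrite !big_ord_recr big_ord0.
rewrite /label /= /side /vside /= card_ord.
have := ltn_ord j; case: {f_vertex f_edge}c => /=; nia.
Qed.

(** The part of the color free of [i], [a] and [c]; the labels of the w_j do not depend on [c], so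
    [false] is an arbitrary choice. *)
Definition K2_color_base (r s : nat) : nat :=
  let n := 2 * s.+1 + 1 in
  n.*2.+2 * r + r + (r - 1) + (uphalf r).-1 + s * (r - 1) + 2 + n
  + \sum_(j < n) label r n false (inl (inr j)).

Lemma tn_color_K2_const (r s : nat) (n := 2 * s.+1 + 1) (c : bool)
    (f : K2join r n + {set K2join r n} -> nat)
    (f_vertex : forall v, f (inl v) = label r n c (inl v))
    (f_edge : forall e, f (inr (edge_set e)) = label r n c (inr e))
    (i : 'I_r) (a : 'I_2) :
  tn_color f (inl (i, a)) =
    K2_color_base r s + vside n c (rev_ord a) * r
    + (\sum_(j < n) side n a j) * r.
Proof.
rewrite (tn_color_K2 f_vertex f_edge) big_split /=.
have -> : \sum_(j < n) label r n c (inr (inr ((i, a), j)))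
    = (\sum_(j < n) side n a j) * r + \sum_(j < n) off r j i + n.
  rewrite -[X in _ + X]card_ord -sum1_card big_distrl -!big_split /=.
  by apply: eq_bigr => j _; rewrite /label /= addn1.
rewrite (sum_off s (ltn_ord i)) /K2_color_base /label /= -/n.
(* The index [i] enters as [i.*2 + zig r i - zag r i - i], which is constant. *)
have := add_zig (ltn_ord i); have := zag_le (ltn_ord i); have := ltn_ord i; lia.
Qed.

Lemma sum_side_gap n : 0 < n ->
  \sum_(j < n) side n 0 j + n <= \sum_(j < n) side n 1 j.
Proof.
move=> n0; rewrite -[X in _ + X]card_ord -sum1_card -big_split /=.
by apply: leq_sum => j _; rewrite /side /=; have := ltn_ord j; lia.
Qed.

Lemma num_colors_eq3 (r n : nat) (f : K2join r n + {set K2join r n} -> nat)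
    (A : 'I_2 -> nat) (C : nat) :
  0 < r -> 0 < n ->
  (forall i a, tn_color f (inl (i, a)) = A a) ->
  (forall j, tn_color f (inr j) = C) ->
  uniq [:: A ord0; A ord_max; C] -> num_colors f = 3.
Proof.
move=> r0 n0 fA fC A_uniq; rewrite /num_colors.
apply: (@perm_size _ _ [:: A ord0; A ord_max; C]).
apply: uniq_perm => [||k]; rewrite ?undup_uniq // mem_undup.
apply/codomP/idP => [[[[i a]|j] ->]|].
- by rewrite fA !inE; case: (ord2P a) => ->; rewrite eqxx ?orbT.
- by rewrite fC !inE eqxx !orbT.
rewrite !inE => /or3P[]/eqP->.
- by exists (inl (Ordinal r0, ord0)).
- by exists (inl (Ordinal r0, ord_max)).
- by exists (inr (Ordinal n0)).
Qed.

Theorem theorem2p2 (r s : nat) (hr : 1 <= r) (hs : 1 <= s) :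
  chi_ltna_is (join (copies r (complete_graph 2)) (null_graph (2 * s + 1))) 3.
Proof.
(* Now [n] is at least 3, so column 1, which carries [zig], exists. *)
case: s hs => // s _; set n := 2 * s.+1 + 1.
have n0 : 0 < n by rewrite /n; lia.
pose i0 := Ordinal hr; pose j0 := Ordinal n0; split.
- by move=> [x|j]; [exists (inr j0)|exists (inl (i0, ord0))].
- pose A c (a : 'I_2) :=
    K2_color_base r s + vside n c (rev_ord a) * r
    + (\sum_(j < n) side n a j) * r.
  have [c Ac] : exists c, uniq [:: A c ord0; A c ord_max; null_color r n].
    have n3 : 3 <= n by rewrite /n; lia.
    have := sum_side_gap n0.
    set S0 := \sum_(j < n) side n 0 j.
    set S1 := \sum_(j < n) side n 1 j => gapS.
    have {gapS} [k S1E] : exists k, S1 = S0 + 3 + k.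
      by exists (S1 - (S0 + 3)); lia.
    set C := null_color r n; set K := K2_color_base r s.
    (* Each color counts the vertex block of the other end. Up to a common shift, [B true] is [r]
       times S0, S1 + 1 and [B false] is [r] times S0 + 1, S1: four distinct values, as S1 is at
       least S0 + 3. *)
    pose B c := [:: K + vside n c 1 * r + S0 * r; K + vside n c 0 * r + S1 * r].
    have B_uniq c : uniq (B c).
      rewrite /= inE andbT S1E; apply/eqP.
      by rewrite /vside; case: c => /=; nia.
    have [|memC] := boolP (C \in B true); last first.
      exists true; rewrite -[uniq _]/(uniq (rcons (B true) C)).
      by rewrite rcons_uniq memC B_uniq.
    move=> memC; exists false; rewrite -[uniq _]/(uniq (rcons (B false) C)).
    rewrite rcons_uniq B_uniq andbT.
    apply/negP; move: memC; rewrite !inE S1E /vside /=.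
    by move=> /orP[]/eqP-> /orP[]/eqP; nia.
  have [f totf [f_vertex f_edge]] :=
    total_labeling_of_edge_enum (@edge_set_inj r n) (@edge_setP r n) (@label_inj r n c)
      (fun t => label_bounds c t n0).
  have fA i a : tn_color f (inl (i, a)) = A c a by apply: tn_color_K2_const.
  have fC j : tn_color f (inr j) = null_color r n.
    exact: tn_color_null_const f_vertex f_edge j.
  exists f; last exact: num_colors_eq3 fA fC Ac.
  split=> // -[[i a]|j] [[i' a']|j'] //=; rewrite ?fA ?fC; move: Ac;
    rewrite /= !inE negb_or andbT =>
      /andP[/andP[/eqP neAB /eqP neAC] /eqP neBC].
  + rewrite /copies_adj /= => /andP[_].
    by case: (ord2P a) (ord2P a') => -> [] -> // _ /esym.
  + by case: (ord2P a) => ->.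
  + by case: (ord2P a') => -> _ /esym.
move=> f lf.
exact: (@num_colors_ge3 _ f (inl (i0, ord0)) (inl (i0, ord_max)) (inr j0) lf).
Qed.
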